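(* Let $M$ be an $H_v$-module over an $H_v$-ring $R$ and let $A=(\mu_A,\lambda_A)$ be an intuitionistic fuzzy set in $M$ such that, for all $t\in[0,1]$, each of the level sets $U(\mu_A;t)=\{x\in M\mid\mu_A(x)\ge t\}$ and $L(\lambda_A;t)=\{x\in M\mid\lambda_A(x)\le t\}$ that is non-empty is an $H_v$-submodule of $M$. Then $A$ is an intuitionistic fuzzy $H_v$-submodule of $M$.
   Context: Hyperoperations. For a non-empty set $H$, $\mathcal P^*(H)$ is the set of non-empty subsets of $H$; a hyperoperation on $H$ is a map $*:H\times H\to\mathcal P^*(H)$. For subsets $A,B\subseteq H$ put $A*B=\bigcup_{a\in A,b\in B}a*b$, and $x*B=\{x\}*B$, $A*x=A*\{x\}$ (likewise for external hyperoperations $R\times M\to\mathcal P^*(M)$). $(H,* )$ is an $H_v$-semigroup if $(x*(y*z))\cap((x*y)*z)\neq\emptyset$ for all $x,y,z\in H$; it is an $H_v$-group if moreover $a*H=H*a=H$ for all $a\in H$. It is weak commutative if $(x*y)\cap(y*x)\ne\emptyset$ for all $x,y$. An $H_v$-ring is a set $R$ with hyperoperations $+,\cdot$ such that $(R,+)$ is an $H_v$-group, $(R,\cdot)$ is an $H_v$-semigroup, and $(x\cdot(y+z))\cap(x\cdot y+x\cdot z)\neq\emptyset$, $((x+y)\cdot z)\cap(x\cdot z+y\cdot z)\ne\emptyset$ for all $x,y,z\in R$. An $H_v$-module over an $H_v$-ring $R$ is a non-empty set $M$ with a hyperoperation $+$ making $(M,+)$ a weak commutative $H_v$-group and a map $\cdot:R\times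 M\to\mathcal P^*(M)$ such that for all $a,b\in R$, $x,y\in M$: $(a\cdot(x+y))\cap(a\cdot x+a\cdot y)\ne\emptyset$, $((a+b)\cdot x)\cap(a\cdot x+b\cdot x)\neq\emptyset$, $((ab)\cdot x)\cap(a\cdot(b\cdot x))\ne\emptyset$. A non-empty subset $S\subseteq M$ is an $H_v$-submodule of $M$ if $(S,+)$ is an $H_v$-subgroup of $(M,+)$, i.e. $a+S=S+a=S$ for all $a\in S$, and $R\cdot S\subseteq S$. Fuzzy sets. A fuzzy set in $X$ is a map $\mu:X\to[0,1]$. An intuitionistic fuzzy set in $X$ is a pair $A=(\mu_A,\lambda_A)$ of fuzzy sets in $X$ with $0\le\mu_A(x)+\lambda_A(x)\le1$ for all $x\in X$. An intuitionistic fuzzy set $A=(\mu_A,\lambda_A)$ in $M$ is an intuitionistic fuzzy $H_v$-submodule of $M$ if: (1) $\min\{\mu_A(x),\mu_A(y)\}\le\inf\{\mu_A(z)\mid z\in x+y\}$ for all $x,y\in M$; (2) for all $x,a\in M$ there exist $y,z\in M$ with $x\in(a+y)\cap(z+a)$ and $\min\{\mu_A(a),\mu_A(x)\}\le\min\{\mu_A(y),\mu_A(z)\}$; (3) $\mu_A(x)\le\inf\{\mu_A(z)\mid z\in r\cdot x\}$ for all $x\in M$, $r\in R$; (4) $\sup\{\lambda_A(z)\mid z\in x+y\}\le\max\{\lambda_A(x),\lambda_A(y)\}$ for all $x,y\in M$; (5) for all $x,a\in M$ there exist $y,z\in M$ with $x\in(a+y)\cap(z+a)$ and $\max\{\lambda_A(y),\lambda_A(z)\}\le\max\{\lambda_A(a),\lambda_A(x)\}$;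 (6) $\sup\{\lambda_A(z)\mid z\in r\cdot x\}\le\lambda_A(x)$ for all $x\in M$, $r\in R$. *)

(* Defs.v *)
From HB Require Import structures.
From mathcomp Require Import all_boot all_order all_algebra.
From mathcomp Require Import all_classical all_reals.

Set Implicit Arguments.
Unset Strict Implicit.
Unset Printing Implicit Defensive.

Import Order.TTheory GRing.Theory Num.Theory.
Local Open Scope classical_set_scope.
Local Open Scope ring_scope.

Record hyperop (X Y Z : Type) := Hyperop {
  hop :> X -> Y -> set Z;
  hop_nonempty : forall x y, hop x y !=set0 }.

Definition hop_set (X Y Z : Type) (op : hyperop X Y Z) (A : set X) (B : set Y)
    : set Z :=
  \bigcup_(a in A) \bigcup_(b in B) op a b.

Definition Hv_semigroup (H : Type) (op : hyperop H H H) : Prop :=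
  forall x y z : H,
    hop_set op [set x] (op y z) `&` hop_set op (op x y) [set z] !=set0.

Definition Hv_group (H : Type) (op : hyperop H H H) : Prop :=
  Hv_semigroup op /\
  forall a : H, hop_set op [set a] setT = setT /\ hop_set op setT [set a] = setT.

Definition weak_commutative (H : Type) (op : hyperop H H H) : Prop :=
  forall x y : H, op x y `&` op y x !=set0.

Record HvRing := {
  ring_carrier :> Type;
  ring_nonempty : inhabited ring_carrier;
  radd : hyperop ring_carrier ring_carrier ring_carrier;
  rmul : hyperop ring_carrier ring_carrier ring_carrier;
  radd_group : Hv_group radd;
  rmul_semigroup : Hv_semigroup rmul;
  rmul_addr : forall x y z : ring_carrier,
    hop_set rmul [set x] (radd y z) `&` hop_set radd (rmul x y) (rmul x z)
      !=set0;
  rmul_addl : forall x y z : ring_carrier,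
    hop_set rmul (radd x y) [set z] `&` hop_set radd (rmul x z) (rmul y z)
      !=set0 }.

Record HvModule (R : HvRing) := {
  module_carrier :> Type;
  module_nonempty : inhabited module_carrier;
  madd : hyperop module_carrier module_carrier module_carrier;
  mscale : hyperop R module_carrier module_carrier;
  madd_group : Hv_group madd;
  madd_weak_commutative : weak_commutative madd;
  mscale_addr : forall (a : R) (x y : module_carrier),
    hop_set mscale [set a] (madd x y) `&` hop_set madd (mscale a x) (mscale a y)
      !=set0;
  mscale_addl : forall (a b : R) (x : module_carrier),
    hop_set mscale (radd R a b) [set x] `&` hop_set madd (mscale a x) (mscale b x)
      !=set0;
  mscale_mul : forall (a b : R) (x : module_carrier),
    hop_set mscale (rmul R a b) [set x] `&` hop_set mscale [set a] (mscale b x)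
      !=set0 }.

Definition Hv_subgroup (H : Type) (op : hyperop H H H) (S : set H) : Prop :=
  forall a, S a -> hop_set op [set a] S = S /\ hop_set op S [set a] = S.

Definition Hv_submodule (R : HvRing) (M : HvModule R) (S : set M) : Prop :=
  [/\ S !=set0, Hv_subgroup (madd M) S & hop_set (mscale M) setT S `<=` S].

Record fuzzy_set (K : realType) (X : Type) := FuzzySet {
  degree :> X -> K;
  degree_itv : forall x, 0 <= degree x <= 1 }.

Record intuitionistic_fuzzy_set (K : realType) (X : Type) :=
  IntuitionisticFuzzySet {
    membership : fuzzy_set K X;
    nonmembership : fuzzy_set K X;
    ifs_sum : forall x, 0 <= membership x + nonmembership x <= 1 }.

Definition upper_level (K : realType) (X : Type) (mu : fuzzy_set K X) (t : K)
    : set X :=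
  [set x | t <= mu x].

Definition lower_level (K : realType) (X : Type) (la : fuzzy_set K X) (t : K)
    : set X :=
  [set x | la x <= t].

(* The real [inf] and [sup] below are the true ones: values of hyperoperations
   are non-empty and degrees lie in [0, 1]. *)
Record intuitionistic_fuzzy_Hv_submodule (K : realType) (R : HvRing)
    (M : HvModule R) (A : intuitionistic_fuzzy_set K M) : Prop := {
  ifs_mu_add : forall x y : M,
    Num.min (membership A x) (membership A y)
      <= inf [set membership A z | z in madd M x y];
  ifs_mu_solve : forall x a : M, exists y z : M,
    (madd M a y `&` madd M z a) x /\
    Num.min (membership A a) (membership A x)
      <= Num.min (membership A y) (membership A z);
  ifs_mu_scale : forall (x : M) (r : R),
    membership A x <= inf [set membership A z | z in mscale M r x];
  ifs_la_add : forall x y : M,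
    sup [set nonmembership A z | z in madd M x y]
      <= Num.max (nonmembership A x) (nonmembership A y);
  ifs_la_solve : forall x a : M, exists y z : M,
    (madd M a y `&` madd M z a) x /\
    Num.max (nonmembership A y) (nonmembership A z)
      <= Num.max (nonmembership A a) (nonmembership A x);
  ifs_la_scale : forall (x : M) (r : R),
    sup [set nonmembership A z | z in mscale M r x] <= nonmembership A x }.

(* Main.v *)
Require Import Defs.
From HB Require Import structures.
From mathcomp Require Import all_boot all_order all_algebra.
From mathcomp Require Import all_classical all_reals.

Import Order.TTheory.
Local Open Scope classical_set_scope.
Local Open Scope ring_scope.

(** The level sets at [t = min (mu x) (mu y)] and [t = max (la x) (la y)] both
    contain [x] and [y], so each closure property of an [H_v]-submodule, applied
    to the level set at the right height, is the corresponding fuzzy inequality. *)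

Lemma Hv_subgroup_add (H : Type) (op : hyperop H H H) (S : set H) (x y : H) :
  Hv_subgroup op S -> S x -> S y -> op x y `<=` S.
Proof.
by move=> sub Sx Sy z xyz; have [<- _] := sub x Sx; exists x => //; exists y.
Qed.

(** Reproduction inside [S]: since [x] lies in [S], which equals both [a * S] and [S * a], the first
    equality yields [y] and the second [z]. *)
Lemma Hv_subgroup_solve (H : Type) (op : hyperop H H H) (S : set H) (x a : H) :
  Hv_subgroup op S -> S x -> S a ->
  exists y z, [/\ (op a y `&` op z a) x, S y & S z].
Proof.
move=> sub Sx Sa; have [eqaS eqSa] := sub a Sa.
have : hop_set op [set a] S x by rewrite eqaS.
have : hop_set op S [set a] x by rewrite eqSa.
by move=> [z Sz [_ -> zax]] [_ -> [y Sy ayx]]; exists y, z.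
Qed.

Lemma Hv_submodule_scale (R : HvRing) (M : HvModule R) (S : set M) (r : R)
    (x : M) :
  Hv_submodule S -> S x -> mscale M r x `<=` S.
Proof. by move=> [_ _ RS] Sx z rxz; apply: RS; exists r => //; exists x. Qed.

(** Inclusion in the level set makes [t] a lower bound of the degrees. Non-emptiness of [op x y]
    matters because [inf] of the empty set is 0 by convention. *)
Lemma le_inf_hop (K : realType) (X Y Z : Type) (op : hyperop X Y Z)
    (mu : fuzzy_set K Z) (x : X) (y : Y) (t : K) :
  op x y `<=` upper_level mu t -> t <= inf [set mu z | z in op x y].
Proof.
move=> sub; apply: lb_le_inf; last by move=> _ [z xyz <-]; exact: sub.
by have [z xyz] := hop_nonempty op x y; exists (mu z), z.
Qed.

Lemma sup_hop_le (K : realType) (X Y Z : Type) (op : hyperop X Y Z)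
    (la : fuzzy_set K Z) (x : X) (y : Y) (t : K) :
  op x y `<=` lower_level la t -> sup [set la z | z in op x y] <= t.
Proof.
move=> sub; apply: ge_sup; last by move=> _ [z xyz <-]; exact: sub.
by have [z xyz] := hop_nonempty op x y; exists (la z), z.
Qed.

Theorem theorem4p8 (K : realType) (R : HvRing) (M : HvModule R)
    (A : intuitionistic_fuzzy_set K M)
    (hlevel : forall t : K, 0 <= t <= 1 ->
      (upper_level (membership A) t !=set0 ->
        Hv_submodule (upper_level (membership A) t)) /\
      (lower_level (nonmembership A) t !=set0 ->
        Hv_submodule (lower_level (nonmembership A) t))) :
  intuitionistic_fuzzy_Hv_submodule A.
Proof.
set mu := membership A in hlevel *; set la := nonmembership A in hlevel *.
(* Only heights that are values of [mu] are used: they lie in [0, 1], and [x] itself witnesses that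
   its level set is non-empty. *)
have muP x : Hv_submodule (upper_level mu (mu x)).
  by apply: (hlevel _ (degree_itv mu x)).1; exists x; exact: lexx.
have laP x : Hv_submodule (lower_level la (la x)).
  by apply: (hlevel _ (degree_itv la x)).2; exists x; exact: lexx.
have minP x y : [/\ Hv_submodule (upper_level mu (Num.min (mu x) (mu y))),
    upper_level mu (Num.min (mu x) (mu y)) x
    & upper_level mu (Num.min (mu x) (mu y)) y].
  split; last 2 first.
  - by rewrite /upper_level/= ge_min lexx.
  - by rewrite /upper_level/= ge_min lexx orbT.
  (* The minimum is one of the two degrees, so this is [muP] at [x] or at [y]. *)
  - by case: leP => _; exact: muP.
have maxP x y : [/\ Hv_submodule (lower_level la (Num.max (la x) (la y))),
    lower_level la (Num.max (la x) (la y)) x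
    & lower_level la (Num.max (la x) (la y)) y].
  split; last 2 first.
  - by rewrite /lower_level/= le_max lexx.
  - by rewrite /lower_level/= le_max lexx orbT.
  - by case: leP => _; exact: laP.
split=> [x y|x a|x r|x y|x a|x r].
- have [[_ sub _] Sx Sy] := minP x y.
  by apply: le_inf_hop; exact: Hv_subgroup_add.
- have [[_ sub _] Sa Sx] := minP a x.
  have [y [z [xP Sy Sz]]] := Hv_subgroup_solve _ _ _ _ _ sub Sx Sa.
  (* Membership of [y] and [z] in the level set bounds [mu y] and [mu z] separately; together these
     bound their minimum. *)
  by exists y, z; split; rewrite // le_min; apply/andP.
- by apply: le_inf_hop; apply: Hv_submodule_scale; [exact: muP|exact: lexx].
- have [[_ sub _] Sx Sy] := maxP x y.
  by apply: sup_hop_le; exact: Hv_subgroup_add.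
- have [[_ sub _] Sa Sx] := maxP a x.
  have [y [z [xP Sy Sz]]] := Hv_subgroup_solve _ _ _ _ _ sub Sx Sa.
  by exists y, z; split; rewrite // ge_max; apply/andP.
(* Scaling involves a single module element, so the level at its own degree [la x] suffices. *)
- by apply: sup_hop_le; apply: Hv_submodule_scale; [exact: laP|exact: lexx].
Qed.
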